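(* Let $n$ be odd and let $L$ be a real $n$-self-dual $n$-gon. If $L$ is projectively equivalent to an affine convex $n$-gon, then the corresponding symmetric bilinear form $F$ is definite.
   Context: $V=\mathbb R^3$, $P=\mathbb{RP}^2$ is its projectivization, $P^*$ is the projectivization of $V^*$; for a line $B$ of $P$, $B^*\in P^*$ denotes its annihilator in $V^*$. An $n$-gon in $P$ is a cyclically ordered collection of vertices $A_1,A_3,\dots,A_{2n-1}\in P$ (indices are odd residues modulo $2n$) and sides $B_{2i}=A_{2i-1}A_{2i+1}$ (indices are even residues modulo $2n$). Polygons are non-degenerate: no three consecutive vertices are collinear. For $n$ odd, an $n$-gon is $n$-self-dual if there is a projective isomorphism $\hat f\colon P\to P^*$ with $\hat f(A_i)=B_{i+n}^*$ for all $i$; it is induced by a linear isomorphism $f\colon V\to V^*$, and the corresponding bilinear form is $F(v,w)=\langle f(v),w\rangle$ on $V$ (it is symmetric). Standing convention: for the given self-dual polygon $\hat f$ is unique, so that $f$ and $F$ are unique up to a non-zero real factor. ''Definite'' means positive definite or negative definite. An affine convex $n$-gon is one lying in an affine chart $\mathbb R^2\subset \mathbb{RP}^2$ whose vertices, in their cyclic order, are the successive vertices of a convex polygon. *)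

(* Defs.v *)
From HB Require Import structures.
From mathcomp Require Import all_boot all_order all_algebra.
From mathcomp Require Import reals.

Set Implicit Arguments.
Unset Strict Implicit.
Unset Printing Implicit Defensive.

Import Order.TTheory GRing.Theory Num.Theory.
Local Open Scope ring_scope.

Section Projectivization.
Variables (K : fieldType) (V W : vectType K).

(* The projectivization of V: its one-dimensional subspaces. *)
Record proj_space (U : vectType K) := ProjPoint {
  pline :> {vspace U};
  dim_pline : \dim pline = 1%N
}.

Definition induces (f : 'Hom(V, W)) (phi : proj_space V -> proj_space W) :=
  [/\ lker f = 0%VS, limg f = fullv
    & forall p, pline (phi p) = (f @: p)%VS].

Definition projective_iso (phi : proj_space V -> proj_space W) :=
  exists f : 'Hom(V, W), induces f phi.

Definition collinear (p q r : proj_space V) :=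
  exists l : {vspace V}, \dim l = 2 /\ [/\ p <= l, q <= l & r <= l]%VS.

Definition dual_space : vectType K := 'Hom(V, K^o).

Definition restrict_form (U : {vspace V}) (xi : dual_space) : dual_space :=
  (xi \o projv U)%VF.

Lemma restrict_form_is_linear U : linear (restrict_form U).
Proof.
by move=> a x y; rewrite /restrict_form comp_lfunDl comp_lfunZl.
Qed.

HB.instance Definition _ U :=
  GRing.isLinear.Build K dual_space dual_space _ (restrict_form U)
    (restrict_form_is_linear U).

(* Since projv U is the identity on U and has image U, xi \o projv U vanishes
   exactly when xi vanishes on U; see mem_annihilator. *)
Definition annihilator (U : {vspace V}) : {vspace dual_space} :=
  lker (linfun (restrict_form U)).

Lemma mem_annihilator (U : {vspace V}) (xi : dual_space) :
  reflect (forall u, u \in U -> xi u = 0) (xi \in annihilator U).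
Proof.
rewrite memv_ker lfunE /= /restrict_form; apply: (iffP eqP) => [xi0 u uU|xi0].
  by rewrite -(projv_id uU) -comp_lfunE xi0 zero_lfunE.
by apply/lfunP => v; rewrite comp_lfunE zero_lfunE xi0 // memv_proj.
Qed.

End Projectivization.

Arguments dual_space {K} V.

Section Plane.
Variable R : realType.

Definition V3 : vectType R := 'rV[R]_3.
Definition plane := proj_space V3.
Definition dual_plane := proj_space (dual_space V3).

(* Vertices are indexed by the odd residues modulo 2n.  The values of [vertex]
   at even residues are junk: every condition below involves odd residues
   only.  (Parity of a residue is that of its representative in [0, 2n), and
   'Z_(2 * n) is Z/2nZ as soon as n > 0.) *)
Record polygon (n : nat) := Polygon {
  vertex :> 'Z_(2 * n) -> plane;
  polygon_nondegenerate : forall i : 'Z_(2 * n), odd i ->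
    ~ collinear (vertex i) (vertex (i + 2)) (vertex (i + 4))
}.

(* For j even; the two vertices are distinct by non-degeneracy, so this is
   a line of the plane. *)
Definition side n (L : polygon n) (j : 'Z_(2 * n)) : {vspace V3} :=
  (vertex L (j - 1)%R + vertex L (j + 1)%R)%VS.

Definition self_duality n (L : polygon n) (fhat : plane -> dual_plane) :=
  projective_iso fhat /\
  forall i : 'Z_(2 * n), odd i ->
    pline (fhat (L i)) = annihilator (side L (i + n%:R)).

Definition projectively_equivalent n (L M : polygon n) :=
  exists2 phi : plane -> plane, projective_iso phi &
    forall i : 'Z_(2 * n), odd i -> phi (L i) = M i.

(* (x, y) |-> [x : y : 1] *)
Definition homogeneous (x : 'rV[R]_2) : V3 := row_mx x (const_mx 1 : 'rV_1).

Lemma dim_homogeneous x : \dim <[homogeneous x]>%VS = 1%N.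
Proof.
rewrite dim_vline; suff -> : homogeneous x != 0 by [].
apply/eqP => /(congr1 (fun v : 'rV[R]_(2 + 1) => rsubmx v 0 0)).
by rewrite row_mxKr !mxE; apply/eqP; rewrite oner_eq0.
Qed.

Definition standard_chart (x : 'rV[R]_2) : plane :=
  ProjPoint (dim_homogeneous x).

Definition affine_chart (c : 'rV[R]_2 -> plane) :=
  exists2 phi : plane -> plane, projective_iso phi &
    forall x, c x = phi (standard_chart x).

(* Twice the signed area of the triangle a b c. *)
Definition orient (a b c : 'rV[R]_2) : R :=
  (b 0 0 - a 0 0) * (c 0 1 - a 0 1) - (b 0 1 - a 0 1) * (c 0 0 - a 0 0).

(* The points x_1, x_3, ..., x_(2n-1) are, in this cyclic order, the vertices
   of a convex polygon: for each side x_i x_(i+2), all the other vertices lie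
   strictly on one and the same side of its line (take j = k for strictness). *)
Definition convex_vertices n (x : 'Z_(2 * n) -> 'rV[R]_2) :=
  forall i j k : 'Z_(2 * n), odd i -> odd j -> odd k ->
    j != i -> j != i + 2 -> k != i -> k != i + 2 ->
    0 < orient (x i) (x (i + 2)) (x j) * orient (x i) (x (i + 2)) (x k).

Definition affine_convex n (L : polygon n) :=
  exists2 c, affine_chart c &
  exists2 x : 'Z_(2 * n) -> 'rV[R]_2, convex_vertices x &
    forall i : 'Z_(2 * n), odd i -> L i = c (x i).

Definition assoc_form (f : 'Hom(V3, dual_space V3)) (v w : V3) : R := f v w.

Definition definite (F : V3 -> V3 -> R) :=
  (forall v, v != 0 -> 0 < F v v) \/ (forall v, v != 0 -> F v v < 0).

End Plane.

(* Main.v *)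
(* Lift the vertices of the n-gon, n = 2m+1, to vectors a_0, a_1, ... of period
   n, and write [u v w] for the determinant.  Self-duality says that
   F(a_k, .) = c_k [a_(k+m) a_(k+m+1) .], and convexity that, up to one global
   sign, [a_k a_(k+1) a_l] > 0 for all other l.  Uniqueness of the duality,
   applied to the transpose of F, makes F symmetric, and it excludes n = 3.
   For m >= 2, F(a_k, a_(k+1)) = F(a_(k+1), a_k) compares the signs of c_k and
   c_(k+1), so all F(a_k, a_k) have the same sign.  With u = a_0, v = a_1,
   p, q, r = a_m, a_(m+1), a_(m+2), the Pluecker relation gives
     F(u,u) F(v,v) - F(u,v)^2 = c_0 c_1 [p q r] [u v q] > 0,
   so F is definite on the plane of u and v; its orthogonal complement is
   spanned by q, and F(q,q) has the sign of F(u,u). *)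
From HB Require Import structures.
Require Import Defs.
From mathcomp Require Import all_boot all_order all_algebra.
From mathcomp Require Import reals ring lra zify.
Set Implicit Arguments.
Unset Strict Implicit.
Unset Printing Implicit Defensive.
Import Order.TTheory GRing.Theory Num.Theory.
Local Open Scope ring_scope.

(** * Determinants of three vectors *)

Section Det3.
Variable K : comNzRingType.
Implicit Types u v w p q r : 'rV[K]_3.

Definition det3 u v w : K :=
  let: (i, j, k) := (0, 1, ord_max) in
  u 0 i * (v 0 j * w 0 k - v 0 k * w 0 j)
  - u 0 j * (v 0 i * w 0 k - v 0 k * w 0 i)
  + u 0 k * (v 0 i * w 0 j - v 0 j * w 0 i).

Lemma det3_cramer p q r w :
  det3 p q r *: w = det3 w q r *: p + det3 p w r *: q + det3 p q w *: r.
Proof.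
apply/rowP => i; rewrite !mxE /det3.
have [->|->|->] : [\/ i = 0, i = 1 | i = ord_max].
  case: i => [[|[|[|//]]]] ?; [apply: Or31|apply: Or32|apply: Or33];
    exact: val_inj.
all: by ring.
Qed.

Lemma det3_plucker p q r u v :
  det3 p q u * det3 q r v - det3 p q v * det3 q r u = det3 p q r * det3 u v q.
Proof. by rewrite /det3; ring. Qed.

End Det3.

Lemma det3_homogeneous (R : realType) (x y z : 'rV[R]_2) :
  det3 (homogeneous x) (homogeneous y) (homogeneous z) = orient x y z.
Proof.
have h0 (t : 'rV[R]_2) : homogeneous t 0 0 = t 0 0.
  by rewrite -(row_mxEl t (const_mx 1 : 'rV_1)); congr (_ _ _); apply: val_inj.
have h1 (t : 'rV[R]_2) : homogeneous t 0 1 = t 0 1.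
  by rewrite -(row_mxEl t (const_mx 1 : 'rV_1)); congr (_ _ _); apply: val_inj.
have h2 (t : 'rV[R]_2) : homogeneous t 0 ord_max = 1.
  transitivity (row_mx t (const_mx 1 : 'rV_1) 0 (rshift 2 0)).
    by congr (_ _ _); apply: val_inj.
  by rewrite row_mxEr mxE.
by rewrite /det3 /orient !h0 !h1 !h2; ring.
Qed.

Lemma det3_lfun (K : fieldType) (T : 'End('rV[K]_3)) : exists c,
  forall p q r, det3 (T p) (T q) (T r) = c * det3 p q r.
Proof.
pose A := lin1_mx T.
(* The rows of [A] are the images of the standard basis, so this constant is the determinant of
   [T]. *)
exists (det3 (row 0 A) (row 1 A) (row ord_max A)) => p q r.
have TE v i :
    T v 0 i = v 0 0 * A 0 i + v 0 1 * A 1 i + v 0 ord_max * A ord_max i.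
  rewrite -mul_rV_lin1 mxE !big_ord_recl big_ord0 addr0 addrA.
  by congr (_ + v 0 _ * A _ i + v 0 _ * A _ i); apply: val_inj.
by rewrite /det3 !TE !mxE; ring.
Qed.

Lemma det3_lfun_inj (K : fieldType) (T : 'End('rV[K]_3)) : lker T == 0%VS ->
  exists2 c, c != 0 & forall p q r, det3 (T p) (T q) (T r) = c * det3 p q r.
Proof.
move=> T_inj; have [[c cE] [d dE]] := (det3_lfun T, det3_lfun T^-1%VF).
exists c => //; apply/eqP => c0.
(* On the standard basis, the determinants of [T] and [T^-1] must multiply to 1, which [c = 0]
   forbids. *)
pose e i : 'rV[K]_3 := delta_mx 0 i.
have := dE (T (e 0)) (T (e 1)) (T (e ord_max)).
rewrite !lker0_lfunK // cE c0 /det3 !mxE /= => /eqP.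
by rewrite mul0r !mulr0 !(mulr1, mulr0, mul0r, subr0, addr0) oner_eq0.
Qed.

(** * Definiteness from the lifted vertices *)

Section SelfDualConvexForm.
Variables (R : realType) (f : 'Hom(V3 R, dual_space (V3 R))).
Variables (m : nat) (a : nat -> V3 R) (s : R).
Hypothesis m_gt1 : (1 < m)%N.
Hypothesis a_periodic : forall k, a (k + m.*2.+1)%N = a k.
Hypothesis a_convex : forall k d, (1 < d <= m.*2)%N ->
  0 < s * det3 (a k) (a k.+1) (a (k + d)%N).
Hypothesis a_dual1 : forall k, f (a k) (a (k + m)%N) = 0.
Hypothesis a_dual2 : forall k, f (a k) (a (k + m).+1) = 0.
Hypothesis f_sym : forall k l, f (a k) (a l) = f (a l) (a k).
Hypothesis a_nonisotropic : forall k, f (a k) (a k) != 0.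

(** Modulo the period 2m+1, the index k is k+m advanced by m+1, so a_k is off its dual side. *)
Let convex_opp k : 0 < s * det3 (a (k + m)%N) (a (k + m).+1) (a k).
Proof.
rewrite -(a_periodic k).
have -> : (k + m.*2.+1 = k + m + m.+1)%N by lia.
by apply: a_convex; lia.
Qed.

(** F(a_k, .) kills both ends of the dual side, so Cramer's rule leaves only the coefficient of a_k.
    With s kept in the bracket, c has the sign of F(a_k, a_k). *)
Lemma polar_form k : exists c, forall w,
  f (a k) w = c * (s * det3 (a (k + m)%N) (a (k + m).+1) w).
Proof.
have D0 := lt0r_neq0 (convex_opp k); move: D0.
set p := a _; set q := a _ => D0.
exists (f (a k) (a k) / (s * det3 p q (a k))) => w.
have := congr1 (f (a k)) (det3_cramer p q (a k) w).
rewrite !linearD !linearZ /= a_dual1 a_dual2 !scaler0 !add0r => E.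
have {}E : det3 p q (a k) * f (a k) w = det3 p q w * f (a k) (a k) by [].
apply: (mulfI D0); rewrite -mulrA E; field.
by move: D0; rewrite mulf_eq0 => /norP[-> ->].
Qed.

Lemma polar_sign k :
  exists c d, [/\ 0 < c * d,
    forall w, f (a k) w = c * (s * det3 (a (k + m)%N) (a (k + m).+1) w) &
    forall w, f (a k.+1) w = d * (s * det3 (a (k + m).+1) (a (k + m).+2) w)].
Proof.
have [[c cE] [d dE]] := (polar_form k, polar_form k.+1).
exists c, d; split=> //.
have E := f_sym k k.+1; rewrite cE dE in E; move: E.
have := a_nonisotropic k; rewrite cE mulf_eq0 negb_or => /andP[c0 _].
have : 0 < s * det3 (a (k + m)%N) (a (k + m).+1) (a k.+1).
  rewrite -(a_periodic k.+1).
  (* The offset m+2 is at most 2m because m > 1. *)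
  have -> : (k.+1 + m.*2.+1 = k + m + m.+2)%N by lia.
  by apply: a_convex; lia.
have : 0 < s * det3 (a (k.+1 + m)%N) (a (k.+1 + m).+1) (a k).
  rewrite -(a_periodic k).
  have -> : (k + m.*2.+1 = k.+1 + m + m)%N by lia.
  by apply: a_convex; lia.
move: (s * _) (s * _) => x y x0 y0 E.
(* Multiplying [c * d] by the positive bracket on the right of [E] gives [c ^+ 2] times the one on
   the left. *)
rewrite -(pmulr_lgt0 _ x0) -mulrA -E mulrA -expr2.
by rewrite pmulr_lgt0 // exprn_even_gt0.
Qed.

Lemma squares_same_sign k : 0 < f (a 0%N) (a 0%N) * f (a k) (a k).
Proof.
elim: k => [|k IH]; first by rewrite -expr2 exprn_even_gt0 ?a_nonisotropic.
have [c [d [cd cE dE]]] := polar_sign k.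
have ck := convex_opp k; have dk := convex_opp k.+1.
rewrite dE; rewrite cE in IH; move: IH ck dk.
move: (f (a 0%N) (a 0%N)) (s * det3 _ _ (a k)) (s * det3 _ _ (a k.+1)) => e x y.
rewrite !mulrA => IH x0 y0; rewrite pmulr_lgt0 //.
have {}IH : 0 < e * c by rewrite -(pmulr_lgt0 _ x0).
have c2 : 0 < c ^+ 2.
  by rewrite exprn_even_gt0 //=; apply: contraTneq cd => ->; rewrite mul0r ltxx.
by rewrite -(pmulr_lgt0 _ c2); have := mulr_gt0 IH cd; congr (0 < _); ring.
Qed.

Lemma gram_gt0 :
  f (a 0%N) (a 1%N) ^+ 2 < f (a 0%N) (a 0%N) * f (a 1%N) (a 1%N).
Proof.
(* With the square written F(u,v) F(v,u), each product has one factor c and one factor d; what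
   remains is the left side of the Pluecker relation. *)
rewrite expr2 {2}f_sym -subr_gt0.
have [c [d [cd cE dE]]] := polar_sign 0; rewrite add0n in cE dE.
rewrite !cE !dE.
set p := a m; set q := a m.+1; set r := a m.+2.
have pqr : 0 < s * det3 p q r.
  by have := a_convex m (_ : 1 < 2 <= _)%N; rewrite addn2; apply; lia.
have uvq : 0 < s * det3 (a 0%N) (a 1%N) q by apply: (a_convex 0); lia.
have E := det3_plucker p q r (a 0%N) (a 1%N).
have := mulr_gt0 cd (mulr_gt0 pqr uvq); congr (0 < _).
transitivity (c * d * s ^+ 2 * (det3 p q r * det3 (a 0%N) (a 1%N) q)).
  by ring.
by rewrite -E; ring.
Qed.

Lemma self_dual_convex_definite : definite (assoc_form f).
Proof.
set u := a 0%N; set v := a 1%N; set q := a m.+1.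
suff pos w : w != 0 -> 0 < f u u * f w w.
  have [u0|u0|u0] := ltgtP (f u u) 0.
  - by right=> w /pos; rewrite nmulr_rgt0.
  - by left=> w /pos; rewrite pmulr_rgt0.
  - by have := a_nonisotropic 0; rewrite -/u u0 eqxx.
move=> w0.
have D0 : det3 u v q != 0.
  have /lt0r_neq0 : 0 < s * det3 u v q by apply: (a_convex 0); lia.
  by rewrite mulf_eq0 => /norP[].
have := det3_cramer u v q w.
move: (det3 w v q) (det3 u w q) (det3 u v w) D0 => x y z.
move: (det3 u v q) => D D0 E.
(* The vertex q is the common end of the sides dual to u and v. *)
have uq : f u q = 0 by apply: (a_dual2 0).
have vq : f v q = 0 by rewrite /v /q -[m.+1]add1n a_dual1.
have qu : f q u = 0 by rewrite /q f_sym.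
have qv : f q v = 0 by rewrite /q f_sym.
have vu : f v u = f u v by rewrite /v f_sym.
(* The factor F(u,u) allows completing the square on the plane of u and v without division; the q
   term splits off by orthogonality. *)
have EF : D ^+ 2 * (f u u * f w w) = (x * f u u + y * f u v) ^+ 2
   + y ^+ 2 * (f u u * f v v - f u v ^+ 2) + z ^+ 2 * (f u u * f q q).
  transitivity (f u u * f (D *: w) (D *: w)).
    by rewrite !linearZ /= scale_lfunE /GRing.scale /=; ring.
  rewrite E !linearD !linearZ /= !add_lfunE !scale_lfunE uq vq qu qv vu.
  by rewrite /GRing.scale /=; ring.
have D2 : 0 < D ^+ 2 by rewrite exprn_even_gt0.
rewrite -(pmulr_rgt0 _ D2) EF.
have gr : 0 < f u u * f v v - f u v ^+ 2 by rewrite subr_gt0 gram_gt0.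
have qq := squares_same_sign m.+1; rewrite -/u -/q in qq.
have uu := a_nonisotropic 0; rewrite -/u in uu.
have t1 := sqr_ge0 (x * f u u + y * f u v).
have t2 := mulr_ge0 (sqr_ge0 y) (ltW gr).
have t3 := mulr_ge0 (sqr_ge0 z) (ltW qq).
(* A zero sum of nonnegative terms kills z, then y, then x, whence D w = 0, against w != 0. *)
rewrite lt_neqAle !addr_ge0 // andbT eq_sym; apply/eqP => S0.
have z0 : z = 0.
  have /eqP: z ^+ 2 * (f u u * f q q) = 0 by lra.
  by rewrite mulf_eq0 (gt_eqF qq) orbF sqrf_eq0 => /eqP.
have y0 : y = 0.
  have /eqP: y ^+ 2 * (f u u * f v v - f u v ^+ 2) = 0 by lra.
  by rewrite mulf_eq0 (gt_eqF gr) orbF sqrf_eq0 => /eqP.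
have x0 : x = 0.
  have /eqP: (x * f u u + y * f u v) ^+ 2 = 0 by lra.
  by rewrite y0 mul0r addr0 sqrf_eq0 mulf_eq0 (negPf uu) orbF => /eqP.
move/eqP: E; rewrite x0 y0 z0 !scale0r !addr0 scaler_eq0 (negPf D0) /=.
exact/negP.
Qed.
End SelfDualConvexForm.

(** * Transposes and rank-one maps *)

Section BilinearForms.
Variables (K : fieldType) (V : vectType K).

Definition transpose_at (f : 'Hom(V, dual_space V)) (v w : V) : K^o := f w v.

Lemma transpose_at_is_linear f v : linear (transpose_at f v).
Proof.
by move=> c x y; rewrite /transpose_at linearP add_lfunE scale_lfunE.
Qed.

HB.instance Definition _ f v :=
  GRing.isLinear.Build K V K^o _ (transpose_at f v)
    (transpose_at_is_linear f v).

Definition transpose_fun f (v : V) : dual_space V := linfun (transpose_at f v).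

Lemma transpose_fun_is_linear f : linear (transpose_fun f).
Proof.
move=> c x y; apply/lfunP => w.
by rewrite add_lfunE scale_lfunE !lfunE /= /transpose_at linearP.
Qed.

HB.instance Definition _ f :=
  GRing.isLinear.Build K V (dual_space V) _ (transpose_fun f)
    (transpose_fun_is_linear f).

Definition transpose_form f : 'Hom(V, dual_space V) := linfun (transpose_fun f).

Lemma transpose_formE f v w : transpose_form f v w = f w v.
Proof. by rewrite !lfunE. Qed.

Lemma dual_separates (v : V) : (forall xi : dual_space V, xi v = 0) -> v = 0.
Proof.
move=> v0; rewrite (coord_vbasis (memvf v)) big1 // => i _.
have := v0 (linfun (coord (vbasis fullv) i : V -> K^o)).
by rewrite lfunE /= => ->; rewrite scale0r.
Qed.

(** Every functional is some F(w, .), so all functionals vanish on the kernel of the transpose. *)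
Lemma lker_transpose_form f : limg f = fullv -> lker (transpose_form f) = 0%VS.
Proof.
move=> f_img; apply/eqP; rewrite -subv0; apply/subvP => v.
rewrite memv_ker memv0 => /eqP g0; apply/eqP/dual_separates => xi.
have /memv_imgP[w _ ->] : xi \in limg f by rewrite f_img memvf.
by rewrite -transpose_formE g0 zero_lfunE.
Qed.

Definition rank_one_fun (xi : dual_space V) (y : dual_space V) (v : V) :=
  xi v *: y.

Lemma rank_one_fun_is_linear xi y : linear (rank_one_fun xi y).
Proof. by move=> c u v; rewrite /rank_one_fun linearP scalerDl scalerA. Qed.

HB.instance Definition _ xi y :=
  GRing.isLinear.Build K V (dual_space V) _ (rank_one_fun xi y)
    (rank_one_fun_is_linear xi y).

End BilinearForms.

(** * Odd residues modulo 2n *)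

Section VertexIndex.
Variable n : nat.
Hypothesis n_gt0 : (0 < n)%N.

(** Numbering by k turns the step i + 2 into k + 1 and the period 2n into n. *)
Definition odd_index k : 'Z_(2 * n) := k.*2.+1%:R.

Lemma odd_index_val k : odd_index k = (k.*2.+1 %% (2 * n))%N :> nat.
Proof. by rewrite /odd_index val_Zp_nat //; lia. Qed.

Lemma odd_odd_index k : odd (odd_index k).
Proof. by rewrite odd_index_val odd_mod ?oddM //= odd_double. Qed.

Lemma odd_index_half (i : 'Z_(2 * n)) : odd i -> i = odd_index i./2.
Proof.
by move=> i_odd; rewrite -[LHS]natr_Zp /odd_index -{1}(odd_double_half i) i_odd.
Qed.

Lemma odd_indexS k : odd_index k + 2 = odd_index k.+1.
Proof. by rewrite /odd_index -natrD doubleS addn2. Qed.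

Lemma odd_index_periodic k : odd_index (k + n) = odd_index k.
Proof.
apply: val_inj; rewrite /= !odd_index_val doubleD -addSn -mul2n.
by rewrite -[X in (_ + X)%N]mul2n modnDr.
Qed.

Lemma odd_index_neq k d : (0 < d < n)%N -> odd_index (k + d) != odd_index k.
Proof.
move=> d_bd; apply/eqP => /(congr1 val) /eqP.
rewrite /= !odd_index_val doubleD -addSn -{2}[k.*2.+1]addn0 eqn_modDl mod0n.
by rewrite modn_small; lia.
Qed.
End VertexIndex.

(** For n = 1, three consecutive vertices are a single point, and some line passes through it: span
    it with a vector of a complement. *)
Lemma polygon_gt1 (R : realType) n : polygon R n -> odd n -> (1 < n)%N.
Proof.
case: n => [//|[|//]] L _; case: (@polygon_nondegenerate _ _ L 1) => //.
have -> : 1 + 4 = 1 :> 'Z_(2 * 1) by apply: val_inj.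
have -> : 1 + 2 = 1 :> 'Z_(2 * 1) by apply: val_inj.
set p := L 1.
have pC : vpick (pline p)^C != 0.
  rewrite vpick0 -dimv_eq0; apply/eqP => C0.
  have := dimv_compl p; rewrite C0 dim_pline dimvf /= => /eqP.
  by rewrite /dim /= mul1n.
exists (p + <[vpick (pline p)^C]>)%VS; split; last by split; exact: addvSl.
rewrite dimv_disjoint_sum ?dim_pline ?dim_vline ?pC //.
apply/eqP; rewrite -subv0 -(capv_compl p); apply: capvS => //.
by rewrite -memvE memv_pick.
Qed.

(** * Lifting a convex polygon to vectors *)

Section Lifts.
Variables (R : realType) (m : nat).
Let n := m.*2.+1.
Let n_gt0 : (0 < n)%N. Proof. by []. Qed.
Hypothesis m_gt0 : (0 < m)%N.
Variable L : polygon R n.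

Lemma convex_lifts :
  (exists2 M : polygon R n, projectively_equivalent L M & affine_convex M) ->
  exists (a : nat -> V3 R) (s : R),
    [/\ forall k, pline (L (odd_index n k)) = <[a k]>%VS,
        forall k, a (k + n)%N = a k &
        forall k d, (1 < d <= m.*2)%N ->
          0 < s * det3 (a k) (a k.+1) (a (k + d)%N)].
Proof.
case=> M [phi [g [g_ker g_img gE]] phiE].
case=> chart [psi [h [h_ker _ hE]] chartE] [x x_convex ME].
(* [h] carries the standard chart to that of [M], and the inverse of [g] returns from [M] to [L]. *)
pose T := (g^-1 \o h)%VF.
have T_ker : lker T == 0%VS.
  apply/lker0P => u v; rewrite !comp_lfunE => /(congr1 g).
  rewrite !limg_lfunVK ?g_img ?memvf // => /lker0P; apply; exact/eqP.
have [c c0 cE] := det3_lfun_inj T_ker.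
pose y k := x (odd_index n k).
pose o k d := orient (y k) (y k.+1) (y (k + d)%N).
have y_periodic k : y (k + n)%N = y k by rewrite /y odd_index_periodic.
have oE k : o k 2%N = orient (y k.+1) (y k.+2) (y k).
  by rewrite /o addn2 /orient; ring.
have o_conv k d e : (1 < d < n)%N -> (1 < e < n)%N -> 0 < o k d * o k e.
  move=> d_bd e_bd; rewrite /o /y -odd_indexS.
  have neq f : (1 < f < n)%N -> odd_index n (k + f) != odd_index n k.+1.
    move=> ?; have -> : (k + f = k.+1 + f.-1)%N by lia.
    by apply: odd_index_neq; lia.
  apply: x_convex;
    by rewrite ?odd_odd_index ?odd_indexS ?neq ?odd_index_neq //; lia.
(* Convexity fixes a sign for each side separately. Sides k and k+1 share the triangle k, k+1, k+2,
   whose vertex k is n-1 steps after k+1, so the sign propagates. *)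
have o_sign k : 0 < o 0%N 2%N * o k 2%N.
  elim: k => [|k IH]; first by apply: o_conv; lia.
  have : 0 < o k 2%N * o k.+1 2%N.
    have := o_conv k.+1 n.-1 2%N; rewrite {1}/o.
    have -> : (k.+1 + n.-1 = k + n)%N by lia.
    by rewrite y_periodic -oE; apply; lia.
  move=> /(mulr_gt0 IH) pos.
  have o2 : 0 < o k 2%N ^+ 2 by rewrite expr2 o_conv //; lia.
  by rewrite -(pmulr_lgt0 _ o2); move: pos; congr (0 < _); ring.
(* The sign of s is that of the determinant of [T] times the orientation of the affine polygon. *)
exists (fun k => T (homogeneous (y k))), (c * o 0%N 2%N).
split=> [k|k|k d d_bd].
- have := gE (L (odd_index n k)).
  rewrite phiE ?ME ?chartE ?hE ?odd_odd_index //= => E.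
  rewrite -limg_line limg_comp E.
  by rewrite -limg_comp lker0_compVf ?g_ker // lim1g.
- by rewrite y_periodic.
rewrite cE det3_homogeneous -/(o k d).
have -> : c * o 0%N 2%N * (c * o k d) = c ^+ 2 * (o 0%N 2%N * o k d) by ring.
rewrite pmulr_rgt0 ?exprn_even_gt0 //.
have o2 : 0 < o k 2%N ^+ 2 by rewrite expr2 o_conv //; lia.
have two_bd : (1 < 2 < n)%N by lia.
have := mulr_gt0 (o_sign k) (o_conv k 2%N d two_bd d_bd).
by move=> pos; rewrite -(pmulr_lgt0 _ o2); move: pos; congr (0 < _); ring.
Qed.

(** For i = 2k+1 and n = 2m+1, the dual side i+n starts at i+n-1 = 2(k+m)+1. *)
Lemma index_dual1 k : odd_index n k + n%:R - 1 = odd_index n (k + m)%N.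
Proof.
rewrite /odd_index -natrD; apply/eqP; rewrite subr_eq natr1.
by apply/eqP; congr (_%:R); rewrite /n; lia.
Qed.

Lemma index_dual2 k : odd_index n k + n%:R + 1 = odd_index n (k + m).+1.
Proof. by rewrite /odd_index -natrD natr1; congr (_%:R); rewrite /n; lia. Qed.

(** * Self-duality and its uniqueness, read on the lifts *)

Variables (fhat : plane R -> dual_plane R).
Hypothesis L_self_dual : self_duality L fhat.
Hypothesis fhat_unique : forall ghat, self_duality L ghat -> ghat =1 fhat.
Variable f : 'Hom(V3 R, dual_space (V3 R)).
Hypothesis f_fhat : induces f fhat.
Variables (a : nat -> V3 R) (s : R).
Hypothesis aE : forall k, pline (L (odd_index n k)) = <[a k]>%VS.
Hypothesis a_periodic : forall k, a (k + n)%N = a k.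
Hypothesis a_convex : forall k d, (1 < d <= m.*2)%N ->
  0 < s * det3 (a k) (a k.+1) (a (k + d)%N).

Lemma side_lift k :
  side L (odd_index n k + n%:R) = (<[a (k + m)%N]> + <[a (k + m).+1]>)%VS.
Proof. by rewrite /side index_dual1 index_dual2 !aE. Qed.

Lemma lift_neq0 k : a k != 0.
Proof.
by have := dim_pline (L (odd_index n k)); rewrite aE dim_vline; case: (_ != 0).
Qed.

Lemma polarity_line k :
  <[f (a k)]>%VS = annihilator (<[a (k + m)%N]> + <[a (k + m).+1]>).
Proof.
have [_ _ fE] := f_fhat; have [_ dualE] := L_self_dual.
by rewrite -limg_line -aE -fE dualE ?odd_odd_index // side_lift.
Qed.

Lemma polarity_vertex1 k : f (a k) (a (k + m)%N) = 0.
Proof.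
have := memv_line (f (a k)); rewrite polarity_line => /mem_annihilator; apply.
by rewrite memvE addvSl.
Qed.

Lemma polarity_vertex2 k : f (a k) (a (k + m).+1) = 0.
Proof.
have := memv_line (f (a k)); rewrite polarity_line => /mem_annihilator; apply.
by rewrite memvE addvSr.
Qed.

(** Otherwise F(a_k, .) would vanish on the basis formed by a_k and the ends of its dual side,
    against injectivity of [f]. *)
Lemma polarity_nonisotropic k : f (a k) (a k) != 0.
Proof.
have D0 : det3 (a (k + m)%N) (a (k + m).+1) (a k) != 0.
  rewrite -(a_periodic k).
  have -> : (k + n = k + m + m.+1)%N by rewrite /n; lia.
  have m_bd : (1 < m.+1 <= m.*2)%N by lia.
  by have /lt0r_neq0 := a_convex (k + m)%N m_bd; rewrite mulf_eq0 => /norP[].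
apply/eqP => fa0; have [f_ker _ _] := f_fhat.
have : a k \in lker f.
  rewrite memv_ker; apply/eqP/lfunP => w; apply: (scalerI D0).
  have := congr1 (f (a k)) (det3_cramer (a (k + m)%N) (a (k + m).+1) (a k) w).
  rewrite !linearD !linearZ /= fa0 polarity_vertex1 polarity_vertex2 => ->.
  by rewrite zero_lfunE !scaler0 !addr0.
by rewrite f_ker memv0 (negPf (lift_neq0 k)).
Qed.

(* By uniqueness, [g] and [f] induce the same map of projective planes. *)
Lemma self_duality_scalar (g : 'Hom(V3 R, dual_space (V3 R))) :
  lker g = 0%VS ->
  (forall k, g (a k) (a (k + m)%N) = 0) ->
  (forall k, g (a k) (a (k + m).+1) = 0) ->
  forall v, exists c, g v = c *: f v.
Proof.
move=> g_ker g1 g2 v.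
have dim_g (p : plane R) : \dim (g @: p) = 1%N.
  by rewrite limg_dim_eq ?dim_pline // g_ker capv0.
have [f_ker f_img fE] := f_fhat.
have /fhat_unique ghatE : self_duality L (fun p => ProjPoint (dim_g p)).
  split.
    exists g; split=> //; apply/eqP; rewrite eqEdim subvf -f_img /=.
    by rewrite !limg_dim_eq // ?f_ker ?g_ker capv0.
  move=> i /odd_index_half->; rewrite /= aE side_lift limg_line.
  (* The annihilator is the line of f(a_k), so dimensions agree and one inclusion suffices. *)
  apply/eqP; rewrite eqEdim -{2}polarity_line -!limg_line !limg_dim_eq;
    rewrite ?f_ker ?g_ker ?capv0 // leqnn andbT limg_line -memvE.
  apply/mem_annihilator => _ /memv_addP[_ /vlineP[x ->] [_ /vlineP[y ->] ->]].
  by rewrite linearD !linearZ /= g1 g2 /GRing.scale /= !mulr0 addr0.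
have [->|v0] := eqVneq v 0; first by exists 0; rewrite scale0r linear0.
have dim_v : \dim <[v]> = 1%N by rewrite dim_vline v0.
have := fE (ProjPoint dim_v); rewrite -ghatE /= !limg_line => E.
by apply/vlineP; rewrite -E memv_line.
Qed.

(** Modulo n, passing from k to k+m or k+m+1 is a symmetric relation, so the transpose of F meets
    the same incidences and is proportional to F at a_k; evaluation at a_k makes the factor 1. *)
Lemma polarity_sym k l : f (a k) (a l) = f (a l) (a k).
Proof.
have [_ f_img _] := f_fhat.
have g1 j : transpose_form f (a j) (a (j + m)%N) = 0.
  rewrite transpose_formE -(a_periodic j).
  have -> : (j + n = (j + m + m).+1)%N by rewrite /n; lia.
  exact: polarity_vertex2.
have g2 j : transpose_form f (a j) (a (j + m).+1) = 0.
  rewrite transpose_formE -(a_periodic j).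
  have -> : (j + n = (j + m).+1 + m)%N by rewrite /n; lia.
  exact: polarity_vertex1.
have [c cE] := self_duality_scalar (lker_transpose_form f_img) g1 g2 (a k).
have cF w : f w (a k) = c * f (a k) w.
  by rewrite -transpose_formE cE scale_lfunE.
suff -> : f (a l) (a k) = 1 * f (a k) (a l) by rewrite mul1r.
rewrite cF; congr (_ * _); apply: (mulIf (polarity_nonisotropic k)).
by rewrite -cF mul1r.
Qed.

(* A triangle is self-dual for every form that is diagonal in its vertices, so
   uniqueness fails: rescale the form at one vertex. *)
Lemma self_dual_unique_gt3 : (1 < m)%N.
Proof.
rewrite ltn_neqAle m_gt0 andbT; apply/eqP => m1.
have [f_ker _ _] := f_fhat.
have f1 k : f (a k) (a k.+1) = 0.
  by rewrite -[in a k.+1]addn1 m1 polarity_vertex1.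
have f2 k : f (a k) (a k.+2) = 0.
  by have := polarity_vertex2 k; rewrite -m1 addn1.
have a3 k : a k.+3 = a k by have := a_periodic k; rewrite /n -m1 addn3.
pose e := f (a 0%N) (a 0%N); have e0 : e != 0 := polarity_nonisotropic 0.
pose xi : dual_space (V3 R) := e^-1 *: f (a 0%N).
have xi0 : xi (a 0%N) = 1 by rewrite scale_lfunE /GRing.scale /= mulVf.
have xi1 : xi (a 1%N) = 0 by rewrite scale_lfunE f1 scaler0.
have xi2 : xi (a 2%N) = 0 by rewrite scale_lfunE f2 scaler0.
(* This doubles F(a_0, a_0) and leaves f(a_1) and f(a_2) unchanged. *)
pose g : 'Hom(V3 R, dual_space (V3 R)) :=
  (f + linfun (rank_one_fun xi (f (a 0%N))))%VF.
have gE v : g v = f (v + xi v *: a 0%N).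
  by rewrite add_lfunE lfunE /= linearD linearZ.
have g_ker : lker g = 0%VS.
  apply/eqP; rewrite -subv0; apply/subvP => v; rewrite memv_ker memv0 gE.
  rewrite -memv_ker f_ker memv0 addr_eq0 => /eqP vE.
  have : xi v = - xi v.
    by rewrite {1}vE linearN linearZ /= xi0 /GRing.scale /= mulr1.
  move=> xiv; have {}xiv : xi v = 0 by lra.
  by rewrite vE xiv scale0r oppr0.
have gaE k w : f (a k) w = 0 -> g (a k) w = 0.
  rewrite gE linearD linearZ add_lfunE scale_lfunE => fkw; rewrite fkw add0r.
  elim/ltn_ind: k fkw => -[_ fkw|[_ _|[_ _|k IH fkw]]].
  - by rewrite fkw scaler0.
  - by rewrite xi1 scale0r.
  - by rewrite xi2 scale0r.
  by rewrite a3; apply: IH; [lia | rewrite -(a3 k)].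
(* At a_0 + a_1 the two maps are not proportional: pairing with a_1 gives c = 1, with a_0 it gives c
   = 2. *)
have [c] := self_duality_scalar g_ker (fun k => gaE k _ (polarity_vertex1 k))
  (fun k => gaE k _ (polarity_vertex2 k)) (a 0%N + a 1%N).
have xi01 : xi (a 0%N + a 1%N) = 1 by rewrite linearD /= xi0 xi1 addr0.
rewrite gE xi01 scale1r !linearD /= => E.
have f10 : f (a 1%N) (a 0%N) = 0 by rewrite -(a3 0%N) f2.
have := congr1 (fun z : dual_space _ => z (a 0%N)) E.
have := congr1 (fun z : dual_space _ => z (a 1%N)) E.
rewrite /= !(scale_lfunE, add_lfunE) f1 f10 -/e.
rewrite /GRing.scale /= !(mulr0, add0r, addr0) => E1 E0.
have c1 : c = 1 by apply: (mulIf (polarity_nonisotropic 1)); rewrite -E1 mul1r.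
by move: E0; rewrite c1 mul1r => /eqP; rewrite -subr_eq0 addrK (negPf e0).
Qed.

End Lifts.

Theorem proposition9 (R : realType) (n : nat) (n_odd : odd n)
    (L : polygon R n) (fhat : plane R -> dual_plane R)
    (L_self_dual : self_duality L fhat)
    (fhat_unique : forall ghat, self_duality L ghat -> ghat =1 fhat)
    (f : 'Hom(V3 R, dual_space (V3 R))) (f_fhat : induces f fhat)
    (L_convex : exists2 M : polygon R n,
       projectively_equivalent L M & affine_convex M) :
  definite (assoc_form f).
Proof.
have n_gt1 := polygon_gt1 L n_odd.
move: n./2 (odd_double_half n) => m; rewrite n_odd add1n => nE; subst n.
have m_gt0 : (0 < m)%N by lia.
have [a [s [aE a_periodic a_convex]]] := convex_lifts m_gt0 L_convex.
apply: (self_dual_convex_definite (m := m) (a := a) (s := s)) => //.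
- exact: (self_dual_unique_gt3 m_gt0 L_self_dual fhat_unique f_fhat aE
    a_periodic a_convex).
- exact: (polarity_vertex1 m_gt0 L_self_dual f_fhat aE).
- exact: (polarity_vertex2 m_gt0 L_self_dual f_fhat aE).
- exact: (polarity_sym m_gt0 L_self_dual fhat_unique f_fhat aE
    a_periodic a_convex).
- exact: (polarity_nonisotropic m_gt0 L_self_dual f_fhat aE
    a_periodic a_convex).
Qed.
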